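(* For every $c\ge 1$ there is a constant $a=a(c)\ge 1$, depending only on $c$, such that every bounded, locally compact, incomplete, rectifiably connected metric space $(X,d)$ that is $c$-uniform is quasihyperbolic $a$-John; that is, there is a point $x_0\in X$ such that $X$ is quasihyperbolic $a$-John with center $x_0$.
   Context: Let $(X,d)$ be a locally compact, incomplete, rectifiably connected metric space. Here rectifiably connected means that every two points are joined by a curve of finite $d$-length. Let $\bar X$ be the metric completion and $\partial X=\bar X\setminus X\neq\emptyset$ the metric boundary. For $x\in X$ write $d(x)=\operatorname{dist}(x,\partial X)$. $\ell(\gamma)$ denotes the $d$-length of a curve $\gamma$, and for $u,v\in\gamma$, $\gamma[u,v]$ denotes the part of $\gamma$ between $u$ and $v$. Uniform space: for $c\ge1$, $X$ is $c$-uniform if each pair of points $x,y\in X$ can be joined by a rectifiable curve $\gamma$ in $X$ satisfying (a) $\ell(\gamma)\le c\,d(x,y)$, and (b) $\min\{\ell(\gamma[x,z]),\ell(\gamma[z,y])\}\le c\,d(z)$ for all $z\in\gamma$. Quasihyperbolic metric: $k(x,y)=\inf_\gamma\int_\gamma \frac{|dz|}{d(z)}$, the infimum over all rectifiable curves $\gamma$ in $X$ with endpoints $x,y$, where $|dz|$ is the arc-length element with respect to $d$. It is part of the standing setting that $(X,k)$ is a complete, proper and geodesic metric space. A quasihyperbolic geodesic between $x$ and $y$ is a geodesic arc of $(X,k)$ with endpoints $x,y$, i.e. the image of an isometric embedding of $[0,k(x,y)]$ into $(X,k)$ joining $x$ to $y$. Cone arc: for $a\ge1$, an arc $\gamma$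 in $X$ joining $x$ to $x_0$ is an $a$-cone arc if $\ell(\gamma[x,z])\le a\,d(z)$ for all $z\in\gamma$. Quasihyperbolic John: for $x_0\in X$ and $a\ge1$, $X$ is quasihyperbolic $a$-John with center $x_0$ if for each $x\in X$, every quasihyperbolic geodesic in $X$ joining $x$ to $x_0$ is an $a$-cone arc. *)

(* Defs.v *)
From HB Require Import structures.
From mathcomp Require Import all_boot all_order all_algebra.
From mathcomp Require Import all_classical all_reals all_analysis.

Set Implicit Arguments.
Unset Strict Implicit.
Unset Printing Implicit Defensive.

Import Order.TTheory GRing.Theory Num.Theory.
Import numFieldTopology.Exports numFieldNormedType.Exports.

Local Open Scope classical_set_scope.
Local Open Scope ring_scope.

Section metric_spaces.
Context {R : realType}.

(* The library's structures of complete spaces require a base point; this is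
   the same axiom as [cauchy_cvg], as a predicate on a metric space. *)
Definition complete_space (Y : metricType R) : Prop :=
  forall F : set_system Y, ProperFilter F -> cauchy F -> exists l : Y, F --> l.

Definition bounded_space (Y : metricType R) : Prop :=
  exists M : R, forall x y : Y, mdist x y <= M.

Definition proper_space (Y : metricType R) : Prop :=
  forall (x : Y) (r : R), compact [set y : Y | mdist x y <= r].

(* [g], restricted to [0, rho x y], is an isometric embedding into (T, rho)
   joining x to y; its values outside this interval are irrelevant. *)
Definition geodesic (T : Type) (rho : T -> T -> R) (g : R -> T) (x y : T) :
    Prop :=
  [/\ g 0 = x, g (rho x y) = y &
      {in `[0, rho x y] &, forall s t, rho (g s) (g t) = `|s - t|}].

Definition geodesic_space (Y : metricType R) : Prop :=
  forall x y : Y, exists g : R -> Y, geodesic (@mdist R Y) g x y.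

(* [iota] exhibits [Y] as the metric completion of [X] (unique up to
   isometry). *)
Definition is_completion (X Y : metricType R) (iota : X -> Y) : Prop :=
  [/\ forall x y, mdist (iota x) (iota y) = mdist x y,
      dense (range iota) & complete_space Y].

(* (T, rho) is a complete, proper and geodesic metric space; [Y] is the set
   T endowed with the metric rho. *)
Definition complete_proper_geodesic (T : Type) (rho : T -> T -> R) : Prop :=
  exists (Y : metricType R) (j : T -> Y),
    [/\ bijective j, forall x y, mdist (j x) (j y) = rho x y,
        complete_space Y, proper_space Y & geodesic_space Y].

End metric_spaces.

Section curves.
Context {R : realType} {X : metricType R}.
Implicit Types (g : R -> X) (a b : R).

(* A curve is the restriction of [g] to [a, b]. *)
Definition curve g a b : Prop := a <= b /\ {within `[a, b], continuous g}.

Definition arc g a b : Prop := curve g a b /\ {in `[a, b] &, injective g}.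

(* Same indexing as [variation]: the points are a :: s, of which b is the
   last one. *)
Definition polygonal_length g a b (s : seq R) : R :=
  let F := g \o nth b (a :: s) in
  \sum_(0 <= n < size s) mdist (F n) (F n.+1).

Definition curve_length g a b : \bar R :=
  ereal_sup [set (polygonal_length g a b s)%:E | s in itv_partition a b].

Definition rectifiable g a b : Prop :=
  curve g a b /\ (curve_length g a b < +oo)%E.

(* Arc-length parametrization of a rectifiable curve: the point of the curve
   at distance s from its origin along the curve. All the parameters t with
   length s from a to t give the same point, so the choice is immaterial. *)
Definition arclength_param g a b (s : R) : X :=
  g (xget a [set t | t \in `[a, b] /\ curve_length g a t = s%:E]).

Definition line_integral (f : X -> R) g a b : \bar R :=
  (\int[lebesgue_measure]_(s in `[0%R, fine (curve_length g a b)])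
     (f (arclength_param g a b s))%:E)%E.

Definition rectifiably_connected : Prop :=
  forall x y : X, exists g a b, [/\ rectifiable g a b, g a = x & g b = y].

End curves.

Section quasihyperbolic.
Context {R : realType} {X Y : metricType R}.
(* To be used when [iota] is the embedding of X into its completion Y. *)
Variable iota : X -> Y.

Definition metric_boundary : set Y := ~` range iota.

Definition boundary_dist (x : X) : R :=
  inf [set mdist (iota x) y | y in metric_boundary].

Definition uniform_space (c : R) : Prop :=
  forall x y : X, exists g a b,
    [/\ rectifiable g a b, g a = x, g b = y,
        (curve_length g a b <= (c * mdist x y)%:E)%E &
        forall t, t \in `[a, b] ->
          (Order.min (curve_length g a t) (curve_length g t b)
             <= (c * boundary_dist (g t))%:E)%E].

Definition qh_dist (x y : X) : R :=
  fine (ereal_inf [set r | exists g a b,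
    [/\ rectifiable g a b, g a = x, g b = y &
        r = line_integral (fun z => (boundary_dist z)^-1) g a b]]).

(* The arc is traversed from x = g u to the center x0 = g v. *)
Definition cone_arc (a : R) (g : R -> X) (u v : R) : Prop :=
  arc g u v /\
  forall t, t \in `[u, v] ->
    (curve_length g u t <= (a * boundary_dist (g t))%:E)%E.

Definition qh_john (a : R) (x0 : X) : Prop :=
  forall (x : X) (g : R -> X),
    geodesic qh_dist g x x0 -> cone_arc a g 0 (qh_dist x x0).

End quasihyperbolic.

(* Main.v *)
Require Import Defs.
From HB Require Import structures.
From mathcomp Require Import all_boot all_order all_algebra.
From mathcomp Require Import all_classical all_reals all_analysis.
From mathcomp Require Import ring lra.

Set Implicit Arguments.
Unset Strict Implicit.
Unset Printing Implicit Defensive.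

Import Order.TTheory GRing.Theory Num.Theory.
Import numFieldTopology.Exports numFieldNormedType.Exports.

Local Open Scope classical_set_scope.
Local Open Scope ring_scope.

(** Let f be the distance to the boundary, k the quasihyperbolic metric, and
    choose x0 with f <= 2 f(x0) everywhere. Along a k-geodesic from x to x0:
    - k-close points satisfy mdist y z <= 2 f(y) k(y, z), so a stretch of
      k-length h on which f <= M has length at most 2 M h;
    - following a uniform curve from both ends to its point of balance, with
      steps comparable to f, the number of steps is logarithmic in mdist / f;
    - hence on a stretch of k-length h where f stays comparable to M, h is at
      most logarithmic in h, i.e. h <= K with K depending only on c.
    So from any point of the geodesic, within k-time K, either f doubles or x0
    is reached, and the length up to a point z is bounded by a geometric sum
    dominated by its last term, which is comparable to f(z). *)

(** * Length of curves as a supremum of polygonal lengths *)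

Section curve_length_theory.
Context {R : realType} {X : metricType R}.
Implicit Types (g : R -> X) (a b c : R) (s : seq R).

Lemma polygonal_length_nil g a b : polygonal_length g a b [::] = 0.
Proof. by rewrite /polygonal_length big_geq. Qed.

Lemma polygonal_length_cons g a b x s :
  polygonal_length g a b (x :: s) = mdist (g a) (g x) + polygonal_length g x b s.
Proof. by rewrite /polygonal_length big_nat_recl. Qed.

Lemma polygonal_length_ge0 g a b s : 0 <= polygonal_length g a b s.
Proof. by apply: sumr_ge0 => i _; exact: mdist_ge0. Qed.

Lemma polygonal_length_rcons g a b c s : itv_partition a b s ->
  polygonal_length g a c (rcons s c) =
  polygonal_length g a b s + mdist (g b) (g c).
Proof.
elim: s a => [|x s IH] a.
  by move/itv_partition_nil => ->;
    rewrite /= polygonal_length_cons !polygonal_length_nil addrC.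
move=> /itv_partition_cons/IH E.
by rewrite rcons_cons !polygonal_length_cons E addrA.
Qed.

Lemma itv_partition_rcons a b c s : b < c -> itv_partition a b s ->
  itv_partition a c (rcons s c).
Proof.
by move=> bc /itv_partition_cat/(_ (itv_partition1 bc)); rewrite cats1.
Qed.

(** A real bound tested on finite partitions: concatenation then goes by induction on the partition,
    and the estimates stay within real arithmetic. *)
Definition length_le g a b (r : R) :=
  forall s, itv_partition a b s -> polygonal_length g a b s <= r.

Lemma curve_length_le g a b r :
  length_le g a b r -> (curve_length g a b <= r%:E)%E.
Proof.
by move=> H; apply: ge_ereal_sup => _ /= [s sp <-]; rewrite lee_fin; exact: H.
Qed.

Lemma polygonal_length_le g a b s : itv_partition a b s ->
  ((polygonal_length g a b s)%:E <= curve_length g a b)%E.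
Proof. by move=> sp; apply: ereal_sup_ubound; exists s. Qed.

Lemma length_le_trans g a b r r' : length_le g a b r -> r <= r' ->
  length_le g a b r'.
Proof. by move=> H rr' s /H/le_trans; apply. Qed.

(** Edges ending at or before [c] are charged to [r1]; the first edge that passes [c] is split at
    [c] by the triangle inequality. *)
Lemma length_le_cat g a c b r1 r2 : a <= c -> c <= b ->
  length_le g a c r1 -> length_le g c b r2 -> length_le g a b (r1 + r2).
Proof.
move=> + cb + H2 s; elim: s a r1 => [|x s IH] a r1 ac H1 ps.
  have E := itv_partition_nil ps.
  have ca : a = c by apply/le_anti; rewrite ac E.
  rewrite polygonal_length_nil addr_ge0//.
    by rewrite (le_trans (polygonal_length_ge0 g a c [::]))// H1// ca; split.
  by rewrite (le_trans (polygonal_length_ge0 g c b [::]))// H2// -ca E; split.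
have [/= /andP[ax _] _] := ps; have ps' := itv_partition_cons ps.
rewrite polygonal_length_cons.
have [xc|cx] := leP x c.
  have H : length_le g x c (r1 - mdist (g a) (g x)).
    move=> t tp; rewrite lerBrDl -polygonal_length_cons H1//.
    by case: tp => tp tl; split => //=; rewrite ax.
  by have := IH _ _ xc H ps'; lra.
have Hr : mdist (g c) (g x) + polygonal_length g x b s <= r2.
  rewrite -polygonal_length_cons H2//.
  by case: ps' => tp tl; split => //=; rewrite cx.
have Hl : mdist (g a) (g c) <= r1.
  move: ac; rewrite le_eqVlt => /predU1P[eac|ac].
    rewrite eac mdistxx -(polygonal_length_nil g a c) H1//.
    by rewrite -eac; split.
  have := H1 _ (itv_partition1 ac).
  by rewrite polygonal_length_cons polygonal_length_nil addr0.
have := metric_triangle (g a) (g c) (g x); lra.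
Qed.

Lemma curve_length_ge0 g a b : a <= b -> (0 <= curve_length g a b)%E.
Proof.
rewrite le_eqVlt => /predU1P[->|ab].
  have := @polygonal_length_le g b b [::]; rewrite polygonal_length_nil.
  by apply; split.
apply: le_trans (polygonal_length_le g (itv_partition1 ab)).
by rewrite lee_fin polygonal_length_ge0.
Qed.

(** Appending [c] to a partition of [[a, b]] adds one chord. With the mirror image
    [curve_length_cons], this yields the monotonicity of the length in both end points. *)
Lemma curve_length_rcons g a b c : b <= c ->
  (curve_length g a b + (mdist (g b) (g c))%:E <= curve_length g a c)%E.
Proof.
rewrite le_eqVlt => /predU1P[->|bc]; first by rewrite mdistxx adde0.
rewrite -leeBrDr//; apply: ge_ereal_sup => _ [s ps <-].
rewrite leeBrDr// -EFinD -(polygonal_length_rcons _ _ ps).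
exact/polygonal_length_le/(itv_partition_rcons bc ps).
Qed.

Lemma curve_length_cons g a b c : a <= b ->
  ((mdist (g a) (g b))%:E + curve_length g b c <= curve_length g a c)%E.
Proof.
rewrite le_eqVlt => /predU1P[->|ab]; first by rewrite mdistxx add0e.
rewrite -leeBrDl//; apply: ge_ereal_sup => _ [s [ps ls] <-].
rewrite leeBrDl// -EFinD -polygonal_length_cons.
by apply: polygonal_length_le; split => //=; rewrite ab.
Qed.

Lemma mdist_le_curve_length g a b : a <= b ->
  ((mdist (g a) (g b))%:E <= curve_length g a b)%E.
Proof.
move=> ab; apply: le_trans (curve_length_rcons g a ab).
by rewrite leeDr// curve_length_ge0.
Qed.

Lemma curve_lengthSr g a b c : b <= c ->
  (curve_length g a b <= curve_length g a c)%E.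
Proof.
move=> bc; apply: le_trans (curve_length_rcons g a bc).
by rewrite leeDl// lee_fin mdist_ge0.
Qed.

Lemma curve_lengthSl g a b c : a <= b ->
  (curve_length g b c <= curve_length g a c)%E.
Proof.
move=> ab; apply: le_trans (curve_length_cons g c ab).
by rewrite leeDr// lee_fin mdist_ge0.
Qed.

End curve_length_theory.

(** * Bounds for line integrals *)

(* No measurability is needed: the integral of a nonnegative function is a
   supremum over the simple functions below it. *)
Lemma ge0_le_integral_subset d (T : measurableType d) (R : realType)
    (mu : {measure set T -> \bar R}) (D1 D2 : set T) (f1 f2 : T -> \bar R) :
  D1 `<=` D2 -> (forall x, D1 x -> (0 <= f1 x)%E) ->
  (forall x, D2 x -> (0 <= f2 x)%E) -> (forall x, D1 x -> (f1 x <= f2 x)%E) ->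
  (\int[mu]_(x in D1) f1 x <= \int[mu]_(x in D2) f2 x)%E.
Proof.
move=> D12 f10 f20 f12; rewrite !ge0_integralE//.
apply: le_ereal_sup => _ [h hf1 <-]; exists h => // x.
apply: le_trans (hf1 x) _; rewrite /patch.
case: ifPn => [/set_mem D1x|_].
  by rewrite (mem_set (D12 _ D1x)) f12.
by case: ifPn => // /set_mem /f20.
Qed.

Lemma integral_cst_itv0 (R : realType) (m q : R) : 0 <= q ->
  (\int[lebesgue_measure]_(s in `[0%R, q]) (cst m%:E s) = (m * q)%:E)%E.
Proof.
move=> q0; rewrite integral_cst//= lebesgue_measure_itv /= lte_fin.
case: ltP => [|q0']; first by rewrite oppr0 addr0.
by rewrite mule0 (_ : q = 0) ?mulr0//; apply/le_anti; rewrite q0' q0.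
Qed.

Section line_integral_bounds.
Context {R : realType} {X : metricType R}.
Implicit Types (g : R -> X) (a b : R).

(* Also true where [arclength_param] takes its default value [g a]; thus the
   continuity of the length function is never needed. *)
Lemma arclength_param_mem g a b s : a <= b -> 0 <= s ->
  exists t, [/\ t \in `[a, b], arclength_param g a b s = g t &
                mdist (g a) (g t) <= s].
Proof.
move=> ab s0; rewrite /arclength_param.
case: xgetP => [t _ [tab Et]|_]; last first.
  by exists a; rewrite in_itv /= lexx ab mdistxx.
exists t; split=> //.
rewrite -lee_fin -Et mdist_le_curve_length//.
by move: tab; rewrite in_itv => /andP[].
Qed.

(** Up to arc length [q] the curve stays within [r] of its origin, where the integrand is at least
    [m]. The minimum covers both curves that leave this ball and curves that end inside it. *)
Lemma line_integral_ge (phi : X -> R) g a b (r m : R) :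
  rectifiable g a b -> (forall z, 0 <= phi z) -> 0 <= m -> 0 <= r ->
  (forall z, mdist (g a) z <= r -> m <= phi z) ->
  ((m * Order.min r (mdist (g a) (g b)))%:E <= line_integral phi g a b)%E.
Proof.
move=> [[ab _] Loo] phi0 m0 r0 mphi.
set q := Order.min r _; have q0 : 0 <= q by rewrite le_min r0 mdist_ge0.
have qL : q <= fine (curve_length g a b).
  rewrite -lee_fin fineK ?ge0_fin_numE ?curve_length_ge0//.
  by rewrite (le_trans _ (mdist_le_curve_length g ab))// lee_fin ge_min lexx orbT.
rewrite -integral_cst_itv0//.
apply: ge0_le_integral_subset => [s /=|s _|s _|s /=].
- by rewrite !in_itv /= => /andP[-> /le_trans]; exact.
- by rewrite lee_fin.
- by rewrite lee_fin.
rewrite in_itv /= => /andP[s0 sq]; rewrite lee_fin.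
have [t [_ -> dt]] := arclength_param_mem g ab s0.
by apply: mphi; rewrite (le_trans dt)// (le_trans sq)// ge_min lexx.
Qed.

Lemma line_integral_le (phi : X -> R) g a b (l m : R) :
  a <= b -> (forall z, 0 <= phi z) -> (curve_length g a b <= l%:E)%E ->
  (forall t, t \in `[a, b] -> phi (g t) <= m) ->
  (line_integral phi g a b <= (m * l)%:E)%E.
Proof.
move=> ab phi0 Ll phim; have L0 := curve_length_ge0 g ab.
have m0 : 0 <= m.
  by rewrite (le_trans (phi0 (g a)))// phim// in_itv /= lexx ab.
have Lfin : curve_length g a b \is a fin_num.
  by rewrite ge0_fin_numE// (le_lt_trans Ll)// ltry.
have l0 : 0 <= l by rewrite -lee_fin (le_trans L0).
set q := fine (curve_length g a b).
have ql : q <= l by rewrite -lee_fin fineK.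
have q0 : 0 <= q by rewrite fine_ge0.
have {}ql : ((m * q)%:E <= (m * l)%:E)%E by rewrite lee_fin ler_wpM2l.
apply: le_trans ql.
rewrite -integral_cst_itv0//.
apply: ge0_le_integral_subset => [s //|s _|s _|s /=].
- by rewrite lee_fin.
- by rewrite lee_fin.
rewrite in_itv /= => /andP[s0 _]; rewrite lee_fin.
by have [t [tab -> _]] := arclength_param_mem g ab s0; exact: phim.
Qed.

End line_integral_bounds.

(** * The distance to the metric boundary *)

Section boundary_dist_theory.
Context {R : realType} {X Y : metricType R}.
Variable iota : X -> Y.
Hypothesis compl : is_completion iota.

Local Notation f := (boundary_dist iota).

(** With an empty boundary [iota] would be a surjective isometry, and completeness would pass from
    [Y] to [X]. *)
Lemma metric_boundary_neq0 : ~ complete_space X -> metric_boundary iota !=set0.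
Proof.
have [iso _ cY] := compl; move=> ncX; apply/set0P/eqP => B0; apply: ncX => F PF cF.
have iotaT y : exists x, iota x = y.
  have : ~ metric_boundary iota y by rewrite B0.
  by move=> /contrapT[x _ xy]; exists x.
have cG : cauchy (iota @ F).
  apply/cauchy_exP => e e0; have /cauchyP/(_ _ e0)[x Fx] := cF.
  exists (iota x); rewrite /fmap /=; apply: filterS Fx => z.
  by rewrite !ballEmdist /= iso.
have [l] := cY _ _ cG; have [x <-] := iotaT l => Fl; exists x.
apply/metricType_numDomainType.fcvgrPdist_lt => e e0.
move: Fl => /metricType_numDomainType.cvgrPdist_lt/(_ _ e0).
by apply: filterS => z; rewrite iso.
Qed.

Hypothesis bnd : metric_boundary iota !=set0.

Lemma boundary_dist_has_inf x :
  has_inf [set mdist (iota x) y | y in metric_boundary iota].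
Proof.
split; last by exists 0 => _ [y _ <-]; exact: mdist_ge0.
by have [y By] := bnd; exists (mdist (iota x) y), y.
Qed.

Lemma boundary_dist_lbound x y :
  metric_boundary iota y -> f x <= mdist (iota x) y.
Proof. by move=> By; apply: ge_inf; [exact: (boundary_dist_has_inf x).2|exists y]. Qed.

Lemma boundary_dist_lipschitz x y : f x <= f y + mdist x y.
Proof.
have [iso _ _] := compl; rewrite -lerBlDr.
apply: lb_le_inf; first exact: (boundary_dist_has_inf y).1.
move=> _ [z Bz <-]; rewrite lerBlDr.
rewrite (le_trans (boundary_dist_lbound x Bz))// addrC -iso.
exact: metric_triangle.
Qed.

(** A compact neighbourhood [K] of [x] contains a ball of radius [r], and its image is closed in
    [Y]. By density, a boundary point within [r] of [iota x] would be a limit of points of that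
    image, hence in the range of [iota]. *)
Lemma boundary_dist_gt0 x : locally_compact [set: X] -> 0 < f x.
Proof.
have [iso dX _] := compl; move=> /(_ x I)[K Kx [cK _]].
have {Kx} /metricType_numDomainType.nbhs_mdistP[r /= r0 rK] : nbhs x K.
  by move: Kx; rewrite /within /= nearE /=; apply: filterS => z; exact.
have iotac : continuous iota.
  move=> z; apply/metricType_numDomainType.cvgrPdist_lt => e e0.
  apply/metricType_numDomainType.nbhs_mdistP; exists e => //= w.
  by rewrite iso.
have /(compact_closed (@metric_hausdorff _ Y)) clK : compact (iota @` K).
  by apply: continuous_compact => //; exact: continuous_subspaceT.
apply: (lt_le_trans r0); apply: lb_le_inf; first exact: (boundary_dist_has_inf x).1.
move=> _ [y By <-]; rewrite leNgt; apply/negP => yr; apply: By.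
suff : (iota @` K) y by move=> [z _ <-]; exists z.
rewrite ((closure_id _).1 clK) => B /metricType_numDomainType.nbhs_mdistP[e /= e0 eB].
(* Points this close to [y] are still within [r] of [iota x]. *)
set d := Order.min e (r - mdist (iota x) y).
have d0 : 0 < d by rewrite lt_min e0 subr_gt0.
have [w [yz [z _ zE]]] := dX _ (ex_intro _ y (nbhsx_ballx y _ d0)) (open_interior _).
move: yz; rewrite -zE => /interior_subset; rewrite ballEmdist /= lt_min => /andP[ze zr].
exists (iota z); split; last exact: eB.
exists z => //; apply: rK; rewrite /= -iso.
by rewrite (le_lt_trans (metric_triangle _ y _))// -ltrBrDl.
Qed.

Lemma boundary_dist_bounded : bounded_space X -> exists M, forall x, f x <= M.
Proof.
have [iso dX _] := compl; move=> [M HM]; have [y By] := bnd.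
have [w [yz [z _ zE]]] :=
  dX _ (ex_intro _ y (nbhsx_ballx y 1 ltr01)) (open_interior _).
move: yz; rewrite -zE => /interior_subset; rewrite ballEmdist /= => yz.
exists (M + 1) => x; rewrite (le_trans (boundary_dist_lbound x By))//.
rewrite (le_trans (metric_triangle _ (iota z) _))// lerD// ?iso//.
by rewrite metric_sym ltW.
Qed.

(** The supremum of [f] may not be attained, hence the factor 2; its positivity makes half of it a
    strictly smaller value. *)
Lemma boundary_dist_half_max (x : X) : bounded_space X -> 0 < f x ->
  exists x0, forall y, f y <= 2 * f x0.
Proof.
move=> /boundary_dist_bounded[M HM] fx0.
have hs : has_sup (range f) by split; [exists (f x), x|exists M => _ [y _ <-]].
have s0 : 0 < sup (range f).
  by apply: lt_le_trans fx0 _; apply: sup_upper_bound => //; exists x.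
have [|_ [x0 _ <-] Hx0] := @sup_adherent _ _ (sup (range f) / 2) _ hs.
  by rewrite divr_gt0.
exists x0 => y; have : f y <= sup (range f) by apply: sup_upper_bound => //; exists y.
lra.
Qed.

End boundary_dist_theory.

(** * Local comparison of the metric with the quasihyperbolic one *)

Section qh_dist_bounds.
Context {R : realType} {X Y : metricType R}.
Variable iota : X -> Y.
Local Notation f := (boundary_dist iota).
Local Notation k := (qh_dist iota).
Hypothesis f_gt0 : forall x, 0 < f x.
Hypothesis f_lip : forall x y, f x <= f y + mdist x y.

(** Since [f <= 2 * f x] on the ball of radius [f x] about [x], every curve from [x] to [y] has
    quasihyperbolic length at least [m]. *)
Lemma mdist_le_qh_dist x y : (k x y = 0 -> x = y) -> k x y < 2^-1 ->
  mdist x y <= 2 * f x * k x y.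
Proof.
move=> k0 kh; have fx := f_gt0 x.
have I0 z : 0 <= (f z)^-1 by rewrite invr_ge0 ltW.
pose m := (2 * f x)^-1 * Order.min (f x) (mdist x y).
have : (m%:E <= ereal_inf [set r | exists g a b,
    [/\ rectifiable g a b, g a = x, g b = y &
        r = line_integral (fun z => ((f z)^-1)%R) g a b]])%E.
  apply: le_ereal_inf_tmp => _ [g [a [b [rg ga gb ->]]]].
  rewrite /m -[in mdist x y]ga -gb; apply: line_integral_ge => //.
  - by rewrite invr_ge0 mulr_ge0// ltW.
  - exact: ltW.
  move=> z; rewrite ga => xz; rewrite lef_pV2 ?posrE ?mulr_gt0//.
  by have := f_lip z x; rewrite metric_sym; lra.
move: k0 kh; rewrite /qh_dist; case: ereal_inf => [r||] //=.
- rewrite lee_fin /m mulrC ler_pdivrMr ?mulr_gt0// => _ rh.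
  (* If the minimum were [f x], then [k x y] would be at least 1/2. *)
  by rewrite ge_min => /orP[H|]; [nra|nra].
(* An infinite infimum is turned into 0 by [fine], and then [x = y]. *)
- by move=> /(_ erefl) -> _ _; rewrite mdistxx mulr0.
Qed.

(** A uniform curve from [x] to [y] has length at most [f x / 2], so [f >= f x / 2] along it. *)
Lemma qh_dist_le1 c x y : uniform_space iota c -> c * mdist x y <= f x / 2 ->
  k x y <= 1.
Proof.
move=> uni cxy; have fx := f_gt0 x.
have I0 z : 0 <= (f z)^-1 by rewrite invr_ge0 ltW.
have [g [a [b [rg ga gb Lg _]]]] := uni x y.
have [ab _] := rg.1.
set S := [set r | exists g a b, [/\ rectifiable g a b, g a = x, g b = y &
  r = line_integral (fun z => ((f z)^-1)%R) g a b]].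
have : (ereal_inf S <= ((f x / 2)^-1 * (f x / 2))%:E)%E.
  apply: (@le_trans _ _ (line_integral (fun z => ((f z)^-1)%R) g a b)).
    by apply: ereal_inf_lbound; exists g, a, b.
  apply: line_integral_le => //; first by rewrite (le_trans Lg)// lee_fin.
  move=> t; rewrite in_itv /= => /andP[at_ tb].
  rewrite lef_pV2 ?posrE ?divr_gt0//.
  have : mdist x (g t) <= f x / 2.
    rewrite -lee_fin -ga (le_trans (mdist_le_curve_length g at_))//.
    by rewrite (le_trans (curve_lengthSr _ _ tb))// (le_trans Lg)// lee_fin ga.
  by have := f_lip x (g t); lra.
rewrite mulVf ?gt_eqF ?divr_gt0// /qh_dist -/S.
by case: (ereal_inf S) => [r||] //=; rewrite ?ler01// lee_fin.
Qed.

End qh_dist_bounds.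

(** * Logarithmic bound for [k] by chains along uniform curves *)

Lemma mdist_continuous (R : realType) (X : metricType R) (p : X) :
  continuous (mdist p : X -> R).
Proof.
move=> x; apply/cvgrPdist_lt => e e0.
apply/metricType_numDomainType.nbhs_mdistP; exists e => //= y xy.
rewrite (le_lt_trans _ xy)// ler_norml.
have := metric_triangle p x y; have := metric_triangle p y x.
rewrite (metric_sym y x); lra.
Qed.

Lemma curve_mdist_IVT (R : realType) (X : metricType R) (g : R -> X)
    (a b s t r : R) (p : X) :
  {within `[a, b], continuous g} -> a <= s -> s <= t -> t <= b ->
  Order.min (mdist p (g s)) (mdist p (g t)) <= r
    <= Order.max (mdist p (g s)) (mdist p (g t)) ->
  exists2 u, s <= u <= t & mdist p (g u) = r.
Proof.
move=> cg as_ st tb sr; have cg' : {within `[s, t], continuous g}.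
  apply: continuous_subspaceW cg => u /=; rewrite !in_itv /=.
  by move=> /andP[su ut]; rewrite (le_trans as_ su) (le_trans ut tb).
have [|u + <-] := @IVT R (mdist p \o g) s t r st _ sr.
  move=> u; apply: (@continuous_comp (subspace `[s, t])); first exact: cg'.
  exact: mdist_continuous.
by rewrite in_itv /= => ust; exists u.
Qed.

Section qh_dist_chain.
Context {R : realType} {X Y : metricType R}.
Variable iota : X -> Y.
Local Notation f := (boundary_dist iota).
Local Notation k := (qh_dist iota).
Variable c : R.
Hypothesis c_ge1 : 1 <= c.
Hypothesis f_gt0 : forall x, 0 < f x.
Hypothesis f_lip : forall x y, f x <= f y + mdist x y.
Hypothesis kxx : forall x, k x x = 0.
Hypothesis k_sym : forall x y, k x y = k y x.
Hypothesis k_triangle : forall x y z, k x z <= k x y + k y z.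
Hypothesis uni : uniform_space iota c.

(** The quotient of the step [f / (2 * c)] by the upper bound [(1 + 2 * c) * f] for [F]: the least
    relative gain of [F] in one step. *)
Definition growth_rate : R := (2 * c * (1 + 2 * c))^-1.
Local Notation eta := growth_rate.

Lemma growth_rate_gt0 : 0 < eta.
Proof. by rewrite invr_gt0; have := c_ge1; nra. Qed.

(* From g t, move to a point of the curve at distance f (g t) / (2 c); this costs
   at most 1 in k and multiplies F by at least 1 + eta. *)
Lemma qh_dist_chain (g : R -> X) (F : R -> R) (a b : R) :
  (forall t u, a <= t -> t <= u -> u <= b -> mdist (g t) (g u) <= F u - F t) ->
  (forall t, a <= t -> t < b -> F t <= (1 + 2 * c) * f (g t)) ->
  (forall t r, a <= t -> t <= b -> 0 <= r <= mdist (g t) (g b) ->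
    exists2 u, t <= u <= b & mdist (g t) (g u) = r) ->
  forall n t, a <= t -> t <= b -> F b < (1 + eta) ^+ n * F t ->
    k (g t) (g b) <= n%:R.
Proof.
move=> FV Ff ivt; elim=> [|n IH] t at_ tb.
  (* No step is left: [F b < F t] contradicts [FV]. *)
  rewrite expr0 mul1r => Fbt.
  by have := FV _ _ at_ tb (lexx b); have := mdist_ge0 (g t) (g b); lra.
move: (tb); rewrite le_eqVlt => /predU1P[-> _|tb']; first by rewrite kxx.
have c1 := c_ge1; have ft := f_gt0 (g t); have e0 := growth_rate_gt0.
move=> Fbt; rewrite -natr1.
have c0 : 0 < 2 * c by lra.
have k1 z : mdist (g t) z <= f (g t) / (2 * c) -> k (g t) z <= 1.
  move=> H; apply: (qh_dist_le1 _ _ uni) => //.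
  apply: (@le_trans _ _ (c * (f (g t) / (2 * c)))); first by rewrite ler_wpM2l//; lra.
  by rewrite le_eqVlt; apply/orP; left; apply/eqP; field; lra.
(* Either the end point is within one step, or the intermediate value property provides the next
   point. *)
have [tbr|tbr] := leP (mdist (g t) (g b)) (f (g t) / (2 * c)).
  by rewrite (le_trans (k1 _ tbr))// lerDr ler0n.
have r0 : 0 <= f (g t) / (2 * c) by rewrite divr_ge0 ?ltW.
have [|u /andP[tu ub] Eu] := ivt t (f (g t) / (2 * c)) at_ tb.
  by rewrite r0 ltW.
have au := le_trans at_ tu.
rewrite addrC (le_trans (k_triangle _ (g u) _))// lerD//.
  by apply: k1; rewrite Eu.
apply: IH => //; apply: (lt_le_trans Fbt).
rewrite exprSr -mulrA ler_wpM2l ?exprn_ge0//; first by lra.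
have := FV t u at_ tu ub; rewrite Eu.
suff : eta * F t <= f (g t) / (2 * c) by lra.
rewrite ler_pdivlMr//.
have -> : f (g t) = eta * ((1 + 2 * c) * f (g t)) * (2 * c).
  by rewrite /eta; field; rewrite !gt_eqF//; lra.
by apply: (ler_wpM2r (ltW c0)); apply: (ler_wpM2l (ltW e0)); exact: Ff.
Qed.

(** On each half of a uniform curve, take [F] to be the length from the end point plus [f] there.
    The cone condition bounds the length by [c * f (g t)], and the Lipschitz property of [f] then
    gives [F <= (1 + 2 * c) * f (g t)]. *)
Lemma qh_dist_le x y n :
  c * mdist x y + f x < (1 + eta) ^+ n * f x ->
  c * mdist x y + f y < (1 + eta) ^+ n * f y ->
  k x y <= 2 * n%:R.
Proof.
move=> Hx Hy; have [g [a [b [rg ga gb Lg cone]]]] := uni x y.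
have [[ab cg] _] := rg; have c1 := c_ge1.
have V0 s t : s <= t -> (0 <= curve_length g s t)%E by exact: curve_length_ge0.
have Vle s t : a <= s -> t <= b -> s <= t ->
    (curve_length g s t <= (c * mdist x y)%:E)%E.
  move=> as_ tb st; apply: le_trans Lg.
  exact: le_trans (curve_lengthSr g s tb) (curve_lengthSl g b as_).
have Vfin s t : a <= s -> t <= b -> s <= t -> curve_length g s t \is a fin_num.
  move=> as_ tb st; rewrite ge0_fin_numE ?V0//.
  by rewrite (le_lt_trans (Vle _ _ as_ tb st))// ltry.
(* The point of balance is [m = sup S]. The two lengths are compared only strictly before and
   strictly after it, matching the strict [t < b] in [qh_dist_chain]. *)
pose S := [set t | a <= t <= b /\ (curve_length g a t <= curve_length g t b)%E].
have Sa : S a by split; [rewrite lexx|exact: curve_lengthSr].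
have supS : has_sup S by split; [exists a|exists b => t [/andP[]]].
pose m := sup S.
have am : a <= m by exact: sup_upper_bound.
have mb : m <= b by apply: sup_le_ub; [exists a|move=> t [/andP[]]].
have left_half t : a <= t -> t < m -> (curve_length g a t <= curve_length g t b)%E.
  move=> at_ tm; have [|u [/andP[au ub] uS] tu] := @sup_adherent _ S (m - t) _ supS.
    by rewrite subr_gt0.
  have {}tu : t <= u by apply/ltW; move: tu; rewrite -/m; lra.
  apply: le_trans (curve_lengthSr g a tu) _.
  by apply: le_trans uS _; exact: curve_lengthSl.
have right_half t : m < t -> t <= b -> (curve_length g t b <= curve_length g a t)%E.
  move=> mt tb; rewrite leNgt; apply/negP => /ltW Ht.
  have : t <= m.
    apply: sup_upper_bound => //; split => //.
    by rewrite tb (le_trans am)// ltW.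
  by rewrite leNgt mt.
have xm : k x (g m) <= n%:R.
  rewrite -ga.
  apply: (@qh_dist_chain g (fun t => fine (curve_length g a t) + f x) a m) => //.
  - move=> t u at_ tu um; rewrite opprD addrACA subrr addr0 lerBrDl.
    have ub := le_trans um mb; have tb := le_trans tu ub; have au := le_trans at_ tu.
    by rewrite -lee_fin EFinD !fineK ?Vfin// curve_length_rcons.
  - move=> t at_ tm; have tb : t <= b by rewrite (le_trans (ltW tm)).
    have : t \in `[a, b] by rewrite in_itv /= at_.
    move=> /cone; rewrite (min_idPl (left_half _ at_ tm)).
    rewrite -(fineK (Vfin _ _ (lexx a) tb at_)) lee_fin => H.
    have := f_lip x (g t); rewrite -ga.
    have := mdist_le_curve_length g at_.
    rewrite -(fineK (Vfin _ _ (lexx a) tb at_)) lee_fin; lra.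
  - move=> t r at_ tm /andP[r0 rm].
    apply: (curve_mdist_IVT cg) => //.
    by rewrite mdistxx /Order.min /Order.max; case: ltgtP (mdist_ge0 (g t) (g m)); lra.
  apply: (@le_lt_trans _ _ (c * mdist x y + f x)).
    by rewrite lerD2r -lee_fin fineK ?Vfin ?Vle.
  rewrite (lt_le_trans Hx)// ler_wpM2l ?exprn_ge0//.
    by have := growth_rate_gt0; lra.
  by rewrite lerDr fine_ge0 ?V0.
have ym : k y (g m) <= n%:R.
  (* The second half is traversed backwards by negating the parameter. *)
  rewrite -gb -[b]opprK -[m]opprK.
  apply: (@qh_dist_chain (g \o -%R)
    (fun t => fine (curve_length g (- t) b) + f y) (- b) (- m)) => //.
  - move=> t u; rewrite lerNl => tb tu; rewrite lerNr => um /=.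
    have tu' : - u <= - t by rewrite lerN2.
    rewrite opprD addrACA subrr addr0 lerBrDr addrC metric_sym.
    have au := le_trans am um; have at_ := le_trans au tu'; have ub := le_trans tu' tb.
    by rewrite -lee_fin EFinD !fineK ?Vfin// addeC curve_length_cons.
  - move=> t; rewrite lerNl ltrNr => tb tm /=.
    have at_ : a <= - t by rewrite (le_trans am) ?ltW.
    have : - t \in `[a, b] by rewrite in_itv /= at_.
    move=> /cone; rewrite (min_idPr (right_half _ tm tb)).
    rewrite -(fineK (Vfin _ _ at_ (lexx b) tb)) lee_fin => H.
    have := f_lip y (g (- t)); rewrite -gb metric_sym.
    have := mdist_le_curve_length g tb.
    rewrite -(fineK (Vfin _ _ at_ (lexx b) tb)) lee_fin; lra.
  - move=> t r; rewrite lerNl => tb; rewrite lerNr => mt /= /andP[r0 rm].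
    rewrite opprK in rm *.
    have [//|//|//||u /andP[mu ut] Eu] :=
      @curve_mdist_IVT _ _ g a b m (- t) r (g (- t)) cg.
      rewrite mdistxx /Order.min /Order.max.
      by case: ltgtP (mdist_ge0 (g (- t)) (g m)); lra.
    by exists (- u); [rewrite lerNr ut lerN2 mu|rewrite /= opprK].
  - by rewrite lerN2.
  rewrite !opprK; apply: (@le_lt_trans _ _ (c * mdist x y + f y)).
    by rewrite lerD2r -lee_fin fineK ?Vfin ?Vle.
  rewrite (lt_le_trans Hy)// ler_wpM2l ?exprn_ge0//.
    by have := growth_rate_gt0; lra.
  by rewrite lerDr fine_ge0 ?V0.
rewrite (le_trans (k_triangle x (g m) y))// mulrDl mul1r lerD//.
by rewrite k_sym.
Qed.

End qh_dist_chain.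

(** * Growth of [f] and of length along quasihyperbolic geodesics *)

Lemma bernoulli_le (R : realFieldType) (e : R) m : 0 <= e ->
  1 + m%:R * e <= (1 + e) ^+ m.
Proof.
move=> e0; elim: m => [|m IH]; first by rewrite mul0r addr0 expr0.
have me : 0 <= m%:R * e :> R by rewrite mulr_ge0.
by rewrite exprS -natr1; nra.
Qed.

Lemma lipschitz_length_le (R : realType) (X : metricType R) (g : R -> X)
    (s t A : R) :
  (forall u v, s <= u -> u <= v -> v <= t -> mdist (g u) (g v) <= A * (v - u)) ->
  length_le g s t (A * (t - s)).
Proof.
move=> HA p; elim: p s HA => [|x p IH] s HA ps.
  by rewrite polygonal_length_nil (itv_partition_nil ps) subrr mulr0.
have [/= /andP[/ltW sx _] _] := ps; have ps' := itv_partition_cons ps.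
have xt := itv_partition_le ps'.
rewrite polygonal_length_cons.
have := HA _ _ (lexx s) sx xt.
have := IH x (fun u v xu => HA u v (le_trans sx xu)) ps'.
lra.
Qed.

Section qh_geodesic.
Context {R : realType} {X Y : metricType R}.
Variable iota : X -> Y.
Local Notation f := (boundary_dist iota).
Local Notation k := (qh_dist iota).
Variable c : R.
Hypothesis c_ge1 : 1 <= c.
Hypothesis f_gt0 : forall x, 0 < f x.
Hypothesis f_lip : forall x y, f x <= f y + mdist x y.
Hypothesis kxx : forall x, k x x = 0.
Hypothesis k_eq0 : forall x y, k x y = 0 -> x = y.
Hypothesis k_sym : forall x y, k x y = k y x.
Hypothesis k_triangle : forall x y z, k x z <= k x y + k y z.
Hypothesis uni : uniform_space iota c.

Variables (g : R -> X) (T : R).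
Hypothesis k_g : forall s t, 0 <= s -> s <= t -> t <= T -> k (g s) (g t) = t - s.
Hypothesis f_max : forall x, f x <= 2 * f (g T).

Local Notation eta := (growth_rate c).
(** If [h] exceeds this value, then [h > 16] yields an integer [m] with [h / 16 <= m <= h / 8], and
    the second summand makes [(m * eta)^2] exceed [16 * c * h]. *)
Definition plateau_time : R := 16 + 16 ^+ 3 * c / eta ^+ 2.
Local Notation K := plateau_time.

Lemma geodesic_mdist_le s t : 0 <= s -> s <= t -> t <= T -> t - s <= 4^-1 ->
  mdist (g s) (g t) <= 2 * f (g s) * (t - s)
  /\ mdist (g s) (g t) <= 2 * f (g t) * (t - s).
Proof.
move=> s0 st tT ts; have kst := k_g s0 st tT.
split; rewrite -kst; [|rewrite metric_sym k_sym];
  apply: (mdist_le_qh_dist f_gt0 f_lip) => //; first exact: k_eq0.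
- by rewrite kst; lra.
- exact: k_eq0.
- by rewrite k_sym kst; lra.
Qed.

(** In k-time 1/4 the distance moved is at most half of [f] at the later point, so [f] falls by a
    factor of at most 3/2. *)
Lemma geodesic_harnack n s t : 0 <= s -> s <= t -> t <= T -> t - s <= n%:R / 4 ->
  f (g s) <= 2 ^+ n * f (g t).
Proof.
elim: n s => [|n IH] s s0 st tT.
  rewrite mul0r => ts0; have -> : s = t by lra.
  by rewrite expr0 mul1r.
rewrite -natr1 => tsn.
have [ts|ts] := leP (t - s) (4^-1).
  have [_ H] := geodesic_mdist_le s0 st tT ts.
  have ft := f_gt0 (g t); have := f_lip (g s) (g t).
  have : 2 * f (g t) <= 2 ^+ n.+1 * f (g t).
    by rewrite ler_pM2r// exprS ler_peMr// exprn_ege1// ler1n.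
  nra.
have sT : s + 4^-1 <= T by lra.
have ss : s <= s + 4^-1 by lra.
have ss' : s + 4^-1 - s <= 4^-1 by lra.
have [_ H] := geodesic_mdist_le s0 ss sT ss'.
have := f_lip (g s) (g (s + 4^-1)); have := f_gt0 (g (s + 4^-1)).
have : f (g (s + 4^-1)) <= 2 ^+ n * f (g t) by apply: IH => //; lra.
rewrite exprS; lra.
Qed.

(** The stretch is cut into pieces of k-time at most 1/4, short enough for the local comparison. *)
Lemma geodesic_lipschitz M s t : 0 <= s -> s <= t -> t <= T ->
  (forall u, s <= u -> u <= t -> f (g u) <= M) ->
  mdist (g s) (g t) <= 2 * M * (t - s).
Proof.
move=> + st tT; have [n tsn] : exists n : nat, t - s <= n%:R / 4.
  exists (Num.bound (4 * (t - s))).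
  by have := @archi_boundP _ (4 * (t - s)); move=> /(_ ltac:(lra)); lra.
elim: n s st tsn => [|n IH] s st tsn s0 HM.
  have -> : s = t by move: tsn; rewrite mul0r; lra.
  by rewrite mdistxx subrr mulr0.
have [ts|ts] := leP (t - s) (4^-1).
  have [H _] := geodesic_mdist_le s0 st tT ts.
  by have := HM s (lexx s) st; have := f_gt0 (g s); nra.
have sT : s + 4^-1 <= T by lra.
have ss : s <= s + 4^-1 by lra.
have ss' : s + 4^-1 - s <= 4^-1 by lra.
have [H _] := geodesic_mdist_le s0 ss sT ss'.
have := HM s (lexx s) st.
have : mdist (g (s + 4^-1)) (g t) <= 2 * M * (t - (s + 4^-1)).
  rewrite -natr1 in tsn; apply: IH; [lra|lra|lra|].
  by move=> u su; apply: HM; lra.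
have := metric_triangle (g s) (g (s + 4^-1)) (g t).
move: H; rewrite (_ : s + 4^-1 - s = 4^-1); last by lra.
lra.
Qed.

(** Otherwise the end points are at distance at most [16 * h * f] for [f] at either end, so chains
    of [2 * m] steps suffice, and [h <= 4 * m <= h / 2]. *)
Lemma plateau_time_le M s t : 0 <= s -> s <= t -> t <= T ->
  (forall u, s <= u -> u <= t -> f (g u) <= M) ->
  M <= 8 * f (g s) -> M <= 8 * f (g t) -> t - s <= K.
Proof.
move=> s0 st tT HM Ms Mt; rewrite leNgt; apply/negP => Kh.
have c1 := c_ge1; have e0 := growth_rate_gt0 c_ge1.
set h := t - s in Kh *.
have e20 : 0 < eta ^+ 2 by rewrite exprn_gt0.
have c0 : 0 < c by exact: lt_le_trans ltr01 c1.
have ce0 : 0 < 16 ^+ 3 * c / eta ^+ 2 by rewrite divr_gt0 ?mulr_gt0 ?exprn_gt0.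
have h16 : 16 < h by move: Kh; rewrite /K; lra.
have hbig : 16 ^+ 3 * c < h * eta ^+ 2.
  by rewrite -ltr_pdivrMr//; move: Kh; rewrite /K; lra.
have [m [m1 m2]] : exists m : nat, m%:R <= h / 8 /\ h / 8 < m%:R + 1.
  by exists (Num.truncn (h / 8)); apply/andP; rewrite natr1 truncn_itv//; lra.
(* Squaring Bernoulli's inequality gives growth quadratic in [h], which beats the linear left
   side. *)
have pow : 1 + 16 * c * h < (1 + eta) ^+ (m * 2).
  have me0 : 0 <= m%:R * eta by rewrite mulr_ge0// ltW.
  rewrite exprM; apply: (@lt_le_trans _ _ ((1 + m%:R * eta) ^+ 2)); last first.
    apply: lerXn2r; rewrite ?nnegrE; last exact/bernoulli_le/ltW.
      by rewrite addr_ge0.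
    by rewrite exprn_ge0// addr_ge0// ltW.
  have hm : h / 16 <= m%:R by lra.
  have : (h / 16 * eta) ^+ 2 <= (m%:R * eta) ^+ 2.
    apply: lerXn2r; rewrite ?nnegrE//; last by rewrite ler_pM2r.
    by rewrite mulr_ge0 ?(ltW e0)//; lra.
  have -> : (h / 16 * eta) ^+ 2 = h * (h * eta ^+ 2) / 256 by field.
  have : h * (16 ^+ 3 * c) < h * (h * eta ^+ 2) by rewrite ltr_pM2l//; lra.
  rewrite sqrrD expr1n mul1r mulr2n; lra.
have d := geodesic_lipschitz s0 st tT HM.
have bound z : M <= 8 * f z ->
    c * mdist (g s) (g t) + f z < (1 + eta) ^+ (m * 2) * f z.
  move=> Mz; have fz := f_gt0 z; apply: (@le_lt_trans _ _ ((1 + 16 * c * h) * f z)).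
    have : c * mdist (g s) (g t) <= c * (2 * (8 * f z) * h).
      apply: ler_wpM2l; first by lra.
      by apply: (le_trans d); rewrite ler_wpM2r ?ler_pM2l//; lra.
    lra.
  by rewrite ltr_pM2r.
have := qh_dist_le c_ge1 f_gt0 f_lip kxx k_sym k_triangle uni (bound _ Ms) (bound _ Mt).
rewrite (k_g s0 st tT) -/h natrM; lra.
Qed.

Lemma plateau_time_ge16 : 16 <= K.
Proof.
have e0 := growth_rate_gt0 c_ge1; have := c_ge1.
have : 0 < eta ^+ 2 by rewrite exprn_gt0.
move=> e20 c1; rewrite /K lerDl divr_ge0 ?mulr_ge0 ?exprn_ge0 ?ltW//.
exact: lt_le_trans ltr01 c1.
Qed.

Lemma doubling_time s : 0 <= s -> s <= T -> exists s',
  [/\ s <= s' <= T, s' - s <= K,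
      forall u, s <= u -> u <= s' -> f (g u) <= 4 * f (g s) &
      s' = T \/ 2 * f (g s) <= f (g s')].
Proof.
move=> s0 sT; have fs := f_gt0 (g s).
(* The time bound is [plateau_time_le] with [M = 4 * f (g s)]; at [s' = T], [f_max] bounds [f] from
   below. *)
suff [s' [/andP[ss' s'T] H4 H2]] : exists s', [/\ s <= s' <= T,
    forall u, s <= u -> u <= s' -> f (g u) <= 4 * f (g s) &
    s' = T \/ 2 * f (g s) <= f (g s')].
  exists s'; split => //; first by rewrite ss'.
  apply: plateau_time_le H4 _ _ => //; first by lra.
  by case: H2 => [->|]; [have := f_max (g s)|]; lra.
pose A := [set u | s <= u <= T /\ 2 * f (g s) <= f (g u)].
have [A0|/set0P/negP/negPn/eqP A0] := pselect (A !=set0); last first.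
  exists T; split; [by rewrite sT lexx| |by left].
  move=> u su uT; rewrite leNgt; apply/negP => fu.
  have Au : A u by split; [rewrite su|lra].
  by rewrite A0 in Au.
have infA : has_inf A by split => //; exists s => u [/andP[]].
(* A doubling time within 1/8 of the infimum. Any [u] between the infimum and [s'] is then within
   1/4 of a time [w] where [f <= 2 * f (g s)], so [f <= 3 * f (g s)] at [u]. *)
have [|s' [/andP[ss' s'T] fs'] s'i] := @inf_adherent _ A (8^-1) _ infA; first by lra.
exists s'; split; [by rewrite ss'| |by right].
move=> u su us'.
have si : s <= inf A by apply: lb_le_inf => // v [/andP[]].
have is' : inf A <= s' by apply: ge_inf; [exact: infA.2|split; rewrite ?ss'].
have below v : s <= v -> v < inf A -> f (g v) <= 2 * f (g s).
  move=> sv vi; rewrite leNgt; apply/negP => fv.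
  suff : inf A <= v by rewrite leNgt vi.
  apply: ge_inf; first exact: infA.2.
  by split; [rewrite sv /=; lra|exact: ltW].
have [ui|iu] := ltP u (inf A).
  by have := below u su ui; lra.
suff [w [sw wu uw fw]] : exists w,
    [/\ s <= w, w <= u, u - w <= 4^-1 & f (g w) <= 2 * f (g s)].
  have uT := le_trans us' s'T; have w0 := le_trans s0 sw.
  have [H _] := geodesic_mdist_le w0 wu uT uw.
  have := f_lip (g u) (g w); rewrite metric_sym.
  have := f_gt0 (g w); nra.
have [i8|i8] := leP (inf A - 8^-1) s.
  by exists s; split => //; lra.
exists (inf A - 8^-1); split; [lra|lra|lra|].
by apply: below; lra.
Qed.

(* len[s, t] + P f(g s) <= len[s', t] + P f(g s') with P = 8 K, since the piece
   [s, s'] has length at most P f(g s) and f doubles from s to s'. *)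
Lemma geodesic_length_le N : K <= N%:R / 4 -> forall n s t,
  0 <= s -> s <= t -> t <= T -> 2 * f (g T) < 2 ^+ n * f (g s) ->
  length_le g s t (16 * K * 2 ^+ N * f (g t) - 8 * K * f (g s)).
Proof.
move=> KN; have K16 := plateau_time_ge16; elim=> [|n IH] s t s0 st tT.
  (* The exponent [n] bounds the doublings still possible; [n = 0] contradicts [f_max]. *)
  by rewrite expr0 mul1r => H; have := f_max (g s); lra.
move=> Hn; have fs := f_gt0 (g s).
have [s' [/andP[ss' s'T] s'K H4 H2]] := doubling_time s0 (le_trans st tT).
have len t' : s <= t' -> t' <= s' -> length_le g s t' (8 * K * f (g s)).
  move=> st' t's'; apply: (@length_le_trans _ _ _ _ _ (2 * (4 * f (g s)) * (t' - s))).
    apply: lipschitz_length_le => u v su uv vt'.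
    apply: geodesic_lipschitz => //; [lra|lra|].
    by move=> w uw wv; apply: H4; lra.
  have : t' - s <= K by lra.
  nra.
have [ts'|s't] := leP t s'.
  apply: (length_le_trans (len t st ts')).
  (* No doubling separates [s] from [t], but they are within k-time [K], so the factor [2 ^+ N]
     absorbs the loss. *)
  have : f (g s) <= 2 ^+ N * f (g t) by apply: geodesic_harnack => //; lra.
  nra.
have {}H2 : 2 * f (g s) <= f (g s') by case: H2 => // E; move: s't; lra.
have H : length_le g s' t (16 * K * 2 ^+ N * f (g t) - 8 * K * f (g s')).
  apply: IH => //; [exact: le_trans ss'|exact: ltW|].
  by apply: (lt_le_trans Hn); rewrite exprSr -mulrA ler_pM2l// exprn_gt0.
 apply: (length_le_trans (length_le_cat ss' (ltW s't) (len s' ss' (lexx s')) H)).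
nra.
Qed.

Lemma geodesic_cone_arc N : K <= N%:R / 4 -> 0 <= T ->
  cone_arc iota (16 * K * 2 ^+ N) g 0 T.
Proof.
move=> KN T0; split; last first.
  move=> t; rewrite in_itv /= => /andP[t0 tT].
  apply: curve_length_le; have f0 := f_gt0 (g 0).
  pose n := Num.bound (2 * f (g T) / f (g 0)).
  have Hn : 2 * f (g T) < 2 ^+ n * f (g 0).
    rewrite -ltr_pdivrMr//.
    apply: (@lt_le_trans _ _ n%:R).
      by apply: archi_boundP; rewrite divr_ge0 ?mulr_ge0 ?ltW.
    by rewrite -natrX ler_nat ltnW// ltn_expl.
  apply: (length_le_trans (geodesic_length_le KN (lexx 0) t0 tT Hn)).
  by have := plateau_time_ge16; nra.
have k_abs s t : s \in `[0, T] -> t \in `[0, T] -> k (g s) (g t) = `|s - t|.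
  rewrite !in_itv /= => /andP[s0 sT] /andP[t0 tT].
  have [st|ts] := leP s t; first by rewrite k_g// distrC ger0_norm// subr_ge0.
  by rewrite k_sym k_g ?(ltW ts)// ger0_norm// subr_ge0 ltW.
split; last first.
  move=> s t sT tT E; have := k_abs s t sT tT; rewrite E kxx => /esym/eqP.
  by rewrite normr_eq0 subr_eq0 => /eqP.
split => //; apply/subspace_continuousP => t tT.
have ft := f_gt0 (g t).
apply/metricType_numDomainType.cvgrPdist_lt => e e0.
(* The bound 1/4 keeps [k] below 1/2; the other bound makes [2 * f (g t) * k] less than [e]. *)
apply/nbhs_ballP; exists (Order.min (4^-1) (e / (4 * f (g t)))).
  by rewrite /= lt_min invr_gt0 ltr0n divr_gt0// mulr_gt0.
move=> u; rewrite /ball /= lt_min => /andP[tu4 tue] uT.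
have kE := k_abs t u tT uT.
have : mdist (g t) (g u) <= 2 * f (g t) * k (g t) (g u).
  apply: (mdist_le_qh_dist f_gt0 f_lip); first exact: k_eq0.
  by rewrite kE; lra.
move: tue; rewrite ltr_pdivlMr ?mulr_gt0// kE; lra.
Qed.

End qh_geodesic.

(** * Choice of the constant and of the center *)

Theorem proposition1p3 (R : realType) (c : R) (hc : 1 <= c) :
  exists a : R, 1 <= a /\
    forall (X Xbar : metricType R) (iota : X -> Xbar),
      is_completion iota ->
      locally_compact [set: X] ->
      ~ complete_space X ->
      @rectifiably_connected R X ->
      complete_proper_geodesic (qh_dist iota) ->
      bounded_space X ->
      uniform_space iota c ->
      exists x0 : X, qh_john iota a x0.
Proof.
have K16 := plateau_time_ge16 hc.
pose N := Num.bound (4 * plateau_time c).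
have KN : plateau_time c <= N%:R / 4.
  by rewrite ler_pdivlMr// mulrC ltW// archi_boundP// mulr_ge0// (le_trans _ K16).
exists (16 * plateau_time c * 2 ^+ N); split.
  have : 1 <= 2 ^+ N :> R by rewrite exprn_ege1// ler1n.
  nra.
move=> X Y iota compl lcX incX _ [Z [j [/bij_inj jinj jk _ _ _]]] bX uni.
have bnd := metric_boundary_neq0 compl incX.
have f_gt0 x := boundary_dist_gt0 compl bnd x lcX.
have f_lip := boundary_dist_lipschitz compl bnd.
(* The metric axioms for [k] are transported from [Z] along [j]. *)
have kxx x : qh_dist iota x x = 0 by rewrite -jk mdistxx.
have k_eq0 x y : qh_dist iota x y = 0 -> x = y.
  by rewrite -jk => /mdist_positivity/jinj.
have k_sym x y : qh_dist iota x y = qh_dist iota y x by rewrite -!jk metric_sym.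
have k_triangle x y z : qh_dist iota x z <= qh_dist iota x y + qh_dist iota y z.
  by rewrite -!jk metric_triangle.
(* [X] is inhabited because it is dense in a completion that has a boundary point. *)
have [x _] : exists x : X, True.
  have [y _] := bnd; have [_ dX _] := compl.
  have [_ [_ [x _ _]]] := dX _ (ex_intro _ y I) openT.
  by exists x.
have [x0 f_max] := boundary_dist_half_max compl bnd bX (f_gt0 x).
exists x0 => {}x g [g0 gT kg].
apply: geodesic_cone_arc => //.
- move=> s t s0 st tT; rewrite kg ?in_itv /= ?s0 ?(le_trans s0)//.
  + by rewrite distrC ger0_norm// subr_ge0.
  + by rewrite (le_trans st).
- by rewrite gT.
- by rewrite -jk mdist_ge0.
Qed.
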